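(* For all integers $j\ge 2$ and $r\ge 2$, and every $r$-regular graph $G$ (connected or not), $\zeta_{2j}(G)\le 3+|B(G)|$.
   Context: Graphs are finite and loopless, but may have multiple edges. A bridge is an edge whose deletion results in a graph with exactly one more component than $G$; $B(G)$ is the (possibly empty) set of bridges of $G$. For a non-trivial abelian group $\mathbb{A}$ (written additively, identity $0$), a graph $G$ is zero-sum $\mathbb{A}$-magic if there is a function $\phi: E(G)\to \mathbb{A}\setminus\{0\}$ such that for every vertex $v$ the sum of $\phi(e)$ over all edges $e$ incident to $v$ is $0$. $\mathbb{Z}_n$ is the group of integers modulo $n$, and $\mathbb{Z}_n^k$ is the direct product of $k$ copies of it. For $j\ge 1$, $\zeta_{2j}(G)$ is the smallest positive integer $c$ such that $G$ is zero-sum $\mathbb{Z}_{2j}^c$-magic if such $c$ exists, and $\infty$ otherwise. *)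

(* Defs.v *)
From HB Require Import structures.
From mathcomp Require Import all_boot all_order all_algebra.
From mathcomp Require Import boolp constructive_ereal.

Set Implicit Arguments.
Unset Strict Implicit.
Unset Printing Implicit Defensive.

Import GRing.Theory.

(* Edges form a type of their own, so parallel edges are allowed; each edge has
   exactly two distinct ends, so loops are not. *)
Record multigraph := Multigraph {
  vertex : finType;
  edge : finType;
  ends : edge -> {set vertex};
  card_ends : forall e, #|ends e| = 2
}.

Section Multigraph.
Variable G : multigraph.

Definition degree (v : vertex G) : nat := #|[set e : edge G | v \in ends e]|.

Definition regular (r : nat) : Prop := forall v : vertex G, degree v = r.

Definition adjacent : rel (vertex G) :=
  fun u v => [exists e : edge G, ends e == [set u; v]].

Definition components : nat := n_comp adjacent (vertex G).

Lemma adjacent_sym : symmetric adjacent.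
Proof. by move=> u v; apply: eq_existsb => e; rewrite setUC. Qed.

(* [n_comp] counts connected components only for a symmetric connection. *)
Lemma adjacent_connect_sym : connect_sym adjacent.
Proof. exact: sym_connect_sym adjacent_sym. Qed.

Definition delete_edge (e : edge G) : multigraph :=
  @Multigraph (vertex G) {x : edge G | x != e}
    (fun x => ends (val x)) (fun x => card_ends (val x)).

End Multigraph.

Definition bridge (G : multigraph) (e : edge G) : bool :=
  components (delete_edge e) == (components G).+1.

Definition bridges (G : multigraph) : {set edge G} := [set e | bridge e].

Definition zero_sum_magic (A : zmodType) (G : multigraph) : Prop :=
  exists phi : edge G -> A,
    (forall e, phi e != 0%R) /\
    (forall v : vertex G, (\sum_(e : edge G | v \in ends e) phi e = 0)%R).

(* Row vectors 'rV['Z_n]_c serve as the group Z_n^c.  For n = 2 * j the ring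
   'Z_n is Z/nZ as soon as 0 < j; the value at j = 0 is meaningless. *)
Definition zeta_witness (j : nat) (G : multigraph) : pred nat :=
  fun c => (0 < c) && `[< zero_sum_magic 'rV['Z_(2 * j)]_c G >].

Definition zeta (j : nat) (G : multigraph) : \bar int :=
  match pselect (exists c, zeta_witness j G c) with
  | left exc => ((ex_minn exc)%:Z)%:E
  | right _ => +oo%E
  end.

(* Main.v *)
Require Import Defs.
From mathcomp Require Import all_boot all_order all_algebra.
From mathcomp Require Import boolp constructive_ereal.
From mathcomp Require Import zify.

(** If [r] is even, label every edge with the element [j] of order two.
    If [r] is odd, orient every edge both ways; the resulting darts form an
    [r]-regular bipartite graph between sources and targets (the bipartite
    double cover of [G]), so by Hall's theorem they contain two disjoint
    perfect matchings.  Give the darts of the first matching the weight [v],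
    those of the second the weight [w] and all others the weight [u], where
    [(r - 2) u + v + w = 0], and label each edge with the sum of the weights of
    its two darts.  The sum at every vertex vanishes, and the labels are nonzero
    as soon as no two of [u], [v], [w] (equal or not) are opposite.  In
    [Z_{2j}^2] one can take [u = (1, 0)], [v = (0, 1)] and [w = (2 - r, -1)]:
    the number [zeta j G] is in fact at most 2, whatever the bridges. *)

Set Implicit Arguments.
Unset Strict Implicit.
Unset Printing Implicit Defensive.

Import GRing.Theory.

(** * Hall's marriage theorem *)

Definition hall_condition {A B : finType} (N : A -> {set B}) : Prop :=
  forall S : {set A}, #|S| <= #|\bigcup_(a in S) N a|.

(** If deleting [x] and deleting [y] both failed, some sets [a |: S] and [a |: T] would violate the
    condition. Since [x != y], the two shrunken copies of [N a] together still cover it, so Hall's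
    condition for [N] on [a |: (S :|: T)] and on [S :&: T] contradicts the two violations. *)
Lemma hall_condition_shrink (A B : finType) (N : A -> {set B}) a x y :
  hall_condition N -> x \in N a -> y \in N a -> x != y ->
  exists2 z, z \in N a &
    hall_condition (fun b => if b == a then N a :\ z else N b).
Proof.
move=> hallN xNa yNa neq_xy; apply: contrapT => noshrink.
have violation z : z \in N a -> exists2 S : {set A}, a \notin S &
    #|(\bigcup_(b in S) N b) :|: (N a :\ z)| <= #|S|.
  move=> zNa; have /existsNP[S /negP] :
      ~ hall_condition (fun b => if b == a then N a :\ z else N b).
    by move=> hz; apply: noshrink; exists z.
  rewrite -ltnNge => ltS.
  have offa (T : {set A}) : a \notin T ->
      \bigcup_(b in T) (if b == a then N a :\ z else N b) = \bigcup_(b in T) N b.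
    by move=> aT; apply: eq_bigr => b bT; case: eqP bT aT => // -> ->.
  (* A violating set must contain [a], the only index where the family changed. *)
  have aS : a \in S.
    by apply: contraLR ltS => aS; rewrite offa // -leqNgt hallN.
  exists (S :\ a); first by rewrite setD11.
  move: ltS; rewrite (cardsD1 a S) aS (big_setD1 a aS) /= eqxx offa ?setD11 //.
  by rewrite setUC.
have [S aS leS] := violation x xNa; have [T aT leT] := violation y yNa.
set P := _ :|: _ in leS; set Q := _ :|: _ in leT.
(* Submodularity of the neighbourhood size. *)
have leU : #|S :|: T|.+1 <= #|P :|: Q|.
  have aST : a \notin S :|: T by rewrite inE negb_or aS.
  rewrite (leq_trans _ (subset_leq_card (_ : \bigcup_(b in a |: (S :|: T)) N b \subset _))) //.
    by rewrite (leq_trans _ (hallN _)) // cardsU1 aST.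
  apply/bigcupsP => b; rewrite !inE => /or3P[/eqP ->|bS|bT]; apply/subsetP => z zN.
  - rewrite !inE zN !andbT; case: (eqVneq z x) => [->|_]; last by rewrite orbT.
    by rewrite neq_xy !orbT.
  - by rewrite !inE; apply/orP; left; apply/orP; left; apply/bigcupP; exists b.
  - by rewrite !inE; apply/orP; right; apply/orP; left; apply/bigcupP; exists b.
have leI : #|S :&: T| <= #|P :&: Q|.
  apply: leq_trans (hallN _) (subset_leq_card _).
  apply/bigcupsP => b /setIP[bS bT]; apply/subsetP => z zN.
  by rewrite !inE; apply/andP; split; apply/orP; left; apply/bigcupP; exists b.
have := cardsUI P Q; have := cardsUI S T; lia.
Qed.

(** Rado's argument: shrink the sets, by induction on their total size, until none has two elements.
    Hall's condition on singletons then makes each set nonempty, and on pairs makes the chosen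
    elements distinct. *)
Lemma hall (A B : finType) (N : A -> {set B}) :
  hall_condition N -> exists2 f : A -> B, injective f & forall a, f a \in N a.
Proof.
have [m] := ubnP (\sum_a #|N a|); elim: m N => // m IHm N ltNm hallN.
case: (pselect (exists a, 1 < #|N a|)) => [[a]|small].
  case/card_gt1P=> x [y [xNa yNa neq_xy]].
  have [z zNa hallN'] := hall_condition_shrink hallN xNa yNa neq_xy.
  have [|f injf fN] := IHm _ _ hallN'; last first.
    exists f => // b; have := fN b; case: eqP => // ->.
    by rewrite inE => /andP[].
  rewrite -ltnS (leq_trans _ ltNm) // ltnS.
  rewrite (bigD1 a) //= (bigD1 a (P := xpredT)) //= eqxx.
  rewrite (cardsD1 z (N a)) zNa add1n addSn ltnS leq_add2l.
  by apply: leq_sum => b /negPf ->.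
have card1 a : #|N a| == 1.
  have := hallN [set a]; rewrite big_set1 cards1 => h.
  by rewrite eqn_leq h andbT leqNgt; apply/negP => lt1; apply: small; exists a.
have ex a : {x | N a = [set x]} by apply: cid; apply/cards1P.
exists (fun a => sval (ex a)) => [a b eqf|a]; last by rewrite {2}(svalP (ex a)) set11.
apply/eqP; apply: contraT => neq_ab; have := hallN [set a; b].
rewrite big_setU1 ?inE //= big_set1 (svalP (ex a)) (svalP (ex b)) eqf setUid.
by rewrite cards2 neq_ab cards1.
Qed.

(** * Perfect matchings in regular bipartite multigraphs *)

Section Darts.
Variables (D V : finType) (src tgt : D -> V).

(** [X] is read as the edge set of a bipartite multigraph whose two sides are copies of [V]; both
    sides are [k]-regular. *)
Definition biregular (X : {set D}) (k : nat) : Prop :=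
  forall v, #|[set d in X | src d == v]| = k /\ #|[set d in X | tgt d == v]| = k.

Lemma card_preim_regular (g : D -> V) (X : {set D}) k (S : {set V}) :
  (forall v, #|[set d in X | g d == v]| = k) ->
  #|[set d in X | g d \in S]| = #|S| * k.
Proof.
move=> reg; rewrite -sum1_card (partition_big g (mem S)) /=; last first.
  by move=> d; rewrite inE => /andP[].
rewrite -sum_nat_const; apply: eq_bigr => v vS; rewrite -(reg v) -sum1_card.
apply: eq_bigl => d; rewrite !inE -andbA; case: (d \in X) => //=.
by case: eqP => [->|]; rewrite ?andbF // andbT vS.
Qed.

(** The [k * #|S|] darts leaving [S] all end among its neighbours, each of which receives [k] darts,
    so Hall's condition holds. *)
Lemma biregular_matching (X : {set D}) k :
  0 < k -> biregular X k -> exists2 M : {set D}, M \subset X & biregular M 1.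
Proof.
move=> k_gt0 regX; pose N v := [set tgt d | d in [set d in X | src d == v]].
have [S|f injf fN] := @hall _ _ N.
  rewrite -(leq_pmul2r k_gt0).
  rewrite -(card_preim_regular S (fun v => proj1 (regX v))).
  rewrite -(card_preim_regular _ (fun v => proj2 (regX v))).
  apply/subset_leq_card/subsetP => d; rewrite !inE => /andP[dX dS]; rewrite dX /=.
  by apply/bigcupP; exists (src d) => //; apply/imsetP; exists d; rewrite // !inE dX eqxx.
have ex v : {d | [/\ d \in X, src d = v & f v = tgt d]}.
  by apply: cid; have /imsetP[d] := fN v; rewrite !inE => /andP[dX /eqP dv] ->; exists d.
pose m v := sval (ex v); pose M := [set m v | v : V].
have mP v : [/\ m v \in X, src (m v) = v & f v = tgt (m v)] by exact: svalP (ex v).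
exists M => [|v]; first by apply/subsetP => _ /imsetP[v _ ->]; case: (mP v).
split; apply/eqP/cards1P.
  exists (m v); apply/setP => d; rewrite !inE; apply/andP/eqP => [[]|->].
    by case/imsetP=> w _ ->; case: (mP w) => _ -> _ /eqP ->.
  by rewrite imset_f //; case: (mP v) => _ -> _.
(* An injective map from the finite type [V] to itself is onto, so the darts [m v] hit every target
   exactly once. *)
have [g fK gK] := injF_bij injf; exists (m (g v)).
apply/setP => d; rewrite !inE; apply/andP/eqP => [[]|->].
  by case/imsetP=> w _ ->; case: (mP w) => _ _ <- /eqP <-; rewrite fK.
by rewrite imset_f //; case: (mP (g v)) => _ _ <-; rewrite gK.
Qed.

Lemma biregularD (X M : {set D}) k l :
  M \subset X -> biregular X k -> biregular M l -> biregular (X :\: M) (k - l).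
Proof.
move=> sMX regX regM v; have [Xs Xt] := regX v; have [Ms Mt] := regM v.
have cardD (g : D -> V) : #|[set d in X :\: M | g d == v]| =
    #|[set d in X | g d == v]| - #|[set d in M | g d == v]|.
  rewrite -cardsDS; last by apply/subsetP => d; rewrite !inE => /andP[/(subsetP sMX) -> ->].
  apply: eq_card => d; rewrite !inE; case: (d \in M) => //=.
  by case: (_ == v); rewrite ?andbF.
by rewrite !cardD Xs Xt Ms Mt.
Qed.

(** At [x] there are one dart of weight [v], one of weight [w] and [r - 2] of weight [u]. The map
    [g] is arbitrary so as to serve for sources and targets alike. *)
Lemma sum_biregular (A : zmodType) (u v w : A) (g : D -> V) (X M1 M2 : {set D}) r x :
  M1 \subset X -> M2 \subset X :\: M1 ->
  #|[set d in X | g d == x]| = r ->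
  #|[set d in M1 | g d == x]| = 1 -> #|[set d in M2 | g d == x]| = 1 ->
  (\sum_(d in X | g d == x)
     (if d \in M1 then v else if d \in M2 then w else u)
   = v + w + u *+ (r - 2))%R.
Proof.
move=> sM1 sM2 cX c1 c2.
pose F d := if d \in M1 then v else if d \in M2 then w else u.
rewrite (eq_bigl (mem [set d in X | g d == x])); last by move=> d; rewrite !inE.
set O := [set d in X | _] in cX *; set P1 := [set d in M1 | _] in c1.
set P2 := [set d in M2 | _] in c2.
have sP1 : P1 \subset O.
  by apply/subsetP => d; rewrite !inE => /andP[/(subsetP sM1) -> ->].
have sP2 : P2 \subset O :\: P1.
  apply/subsetP => d; rewrite !inE => /andP[/(subsetP sM2)]; rewrite inE.
  by case/andP=> /negPf -> -> ->.
rewrite (big_setID P1) /= (big_setID P2 _ (A := O :\: P1)) /=.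
rewrite (setIidPr sP1) (setIidPr sP2) -addrA; congr (_ + (_ + _))%R.
- rewrite (eq_bigr (fun=> v)) ?sumr_const ?c1 // => d.
  by rewrite inE => /andP[->].
- rewrite (eq_bigr (fun=> w)) ?sumr_const ?c2 // => d.
  by rewrite inE => /andP[dM]; have /setDP[_ /negPf ->] := subsetP sM2 _ dM; rewrite dM.
rewrite (eq_bigr (fun=> u)) => [|d]; last first.
  by rewrite !inE => /and3P[]; case: (g d == x); rewrite ?andbF // !andbT => /negPf -> /negPf ->.
by rewrite sumr_const cardsDS // cardsDS // c2 c1 cX -subnDA.
Qed.

End Darts.

(** * The bipartite double cover of a multigraph *)

Section Graph.
Variable G : multigraph.

(** An edge with a chosen source; [darts] keeps the pairs whose vertex really is an end of the
    edge. *)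
Definition dart : finType := (edge G * vertex G)%type.

Definition darts : {set dart} := [set d : dart | d.2 \in ends d.1].

Definition dart_source (d : dart) : vertex G := d.2.

(* The default [d.2] is junk, returned only when [d] is not in [darts]. *)
Definition dart_target (d : dart) : vertex G :=
  odflt d.2 [pick w in ends d.1 :\ d.2].

Lemma dart_ends (d : dart) : d \in darts ->
  dart_target d != d.2 /\ ends d.1 = [set d.2; dart_target d].
Proof.
rewrite inE => dv; have := card_ends d.1; rewrite (cardsD1 d.2) dv => -[].
move/eqP/cards1P=> [w eqw].
have /setD1P[neq _] : w \in ends d.1 :\ d.2 by rewrite eqw set11.
rewrite /dart_target eqw; case: pickP => [w' /set1P ->|/(_ w)]; last by rewrite set11.
by split; rewrite //= -eqw setD1K.
Qed.

Lemma mem_dart_ends (d : dart) x : d \in darts ->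
  (x \in ends d.1) = (d.2 == x) || (dart_target d == x).
Proof. by case/dart_ends=> _ ->; rewrite !inE ![x == _]eq_sym. Qed.

Lemma biregular_darts r : regular G r ->
  biregular dart_source dart_target darts r.
Proof.
move=> regG x; rewrite -(regG x) /degree; split.
  rewrite -(card_imset _ (_ : injective (fun e : edge G => (e, x)))); last by move=> e f [].
  apply: eq_card => -[e y]; rewrite !inE /dart_source /=.
  apply/andP/imsetP => [[ye /eqP <-]|[f]]; first by exists e; rewrite // inE.
  by rewrite inE => fx [-> ->].
(* A dart into [x] starts at the other end of its edge, so darts into [x] correspond to edges at
   [x]. *)
rewrite -(@card_in_imset _ _ (fun d : dart => d.1)) => [|d d'].
  apply: eq_card => e; rewrite !inE; apply/imsetP/idP.
    by case=> d; rewrite inE => /andP[dd dx] ->; rewrite mem_dart_ends // dx orbT.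
  move=> xe; have exd : (e, x) \in darts by rewrite inE.
  have [neq eqe] := dart_ends exd; rewrite /= in neq eqe.
  pose y := dart_target (e, x); have eyd : (e, y) \in darts by rewrite inE /= eqe set22.
  exists (e, y) => //; rewrite inE eyd /=.
  by move: (mem_dart_ends x eyd); rewrite /= xe (negPf neq).
move=> /setIdP[dd /eqP dx] /setIdP[d'd /eqP d'x] eq1.
case: d d' dd dx d'd d'x eq1 => [e y] [f z] /= ed ex fd fx eqef.
subst f; congr (_, _).
have [ney eqy] := dart_ends ed; have [nez _] := dart_ends fd.
have := fd; rewrite inE /= eqy ex !inE /=.
by case/orP=> /eqP // eqz; rewrite /= fx eqz eqxx in nez.
Qed.

Lemma zero_sum_magic_odd_regular (A : zmodType) (u v w : A) r :
  2 <= r -> regular G r -> (v + w + u *+ (r - 2) = 0)%R ->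
  (forall a b, a \in [:: u; v; w] -> b \in [:: u; v; w] -> a + b != 0)%R ->
  zero_sum_magic A G.
Proof.
move=> r_ge2 /biregular_darts regX sum0 nz.
have r_gt0 : 0 < r by lia.
have [M1 sM1 reg1] := biregular_matching r_gt0 regX.
(* Removing [M1] leaves an [(r - 1)]-regular set of darts, and [r >= 2] leaves room for a second
   matching. *)
have r1_gt0 : 0 < r - 1 by lia.
have [M2 sM2 reg2] := biregular_matching r1_gt0 (biregularD sM1 regX reg1).
pose wt d := if d \in M1 then v else if d \in M2 then w else u.
exists (fun e => \sum_(x in ends e) wt (e, x))%R; split=> [e|x].
  have /cards2P[x [y [neq ->]]] : #|ends e| == 2 by rewrite card_ends.
  rewrite big_setU1 ?inE //= big_set1; apply: nz; rewrite /wt;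
    by case: ifP => _; [|case: ifP => _]; rewrite !inE eqxx ?orbT.
(* Each edge at [x] contributes one dart leaving [x] and one entering it. *)
have -> : (\sum_(e | x \in ends e) \sum_(y in ends e) wt (e, y) =
           \sum_(d in darts | dart_source d == x) wt d +
           \sum_(d in darts | dart_target d == x) wt d)%R.
  rewrite pair_big_dep /= (bigID (fun d : dart => dart_source d == x)) /=.
  congr (_ + _)%R; apply: congr_big => // -[e y] //=.
    rewrite /dart_source inE /=; case: eqP => [->|_]; rewrite ?andbF //.
    by rewrite !andbT andbb.
  rewrite inE /= /dart_source /=; case: (boolP (y \in ends e)) => yd; rewrite ?andbF //.
  have ed : (e, y) \in darts by rewrite inE.
  rewrite (mem_dart_ends x ed) /= andbT; have [/= neq _] := dart_ends ed.
  by case: (eqVneq y x) => [<-|_]; rewrite ?andbT //= (negPf neq).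
have [cs ct] := regX x; have [c1s c1t] := reg1 x; have [c2s c2t] := reg2 x.
by rewrite /wt (sum_biregular u v w sM1 sM2 cs c1s c2s)
  (sum_biregular u v w sM1 sM2 ct c1t c2t) sum0 addr0.
Qed.

Lemma zero_sum_magic_even_regular (A : zmodType) (h : A) r :
  ~~ odd r -> regular G r -> (h != 0 -> h *+ 2 = 0 -> zero_sum_magic A G)%R.
Proof.
move=> ev regG h_neq0 h2; exists (fun=> h); split=> // x.
have -> : (\sum_(e : edge G | x \in ends e) h = h *+ degree x)%R.
  by rewrite -sumr_const; apply: eq_bigl => e; rewrite !inE.
by rewrite regG -(even_halfK ev) -mul2n mulrnA h2 mul0rn.
Qed.

End Graph.

(** * Weights in the group Z_{2j}^2 *)

Lemma Zp_natr_eq0 n k : 1 < n -> ((k%:R : 'Z_n) == 0)%R = (n %| k).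
Proof. by move=> n_gt1; rewrite -val_eqE /= val_Zp_nat. Qed.

Lemma zero_sum_magic_regular_Z2j (j r : nat) (G : multigraph) :
  2 <= j -> 2 <= r -> regular G r -> zero_sum_magic 'rV['Z_(2 * j)]_2 G.
Proof.
move=> j_ge2 r_ge2 regG; have n_gt1 : 1 < 2 * j by lia.
have nz k (i : 'I_2) (a : 'rV['Z_(2 * j)]_2) :
    ~~ (2 * j %| k) -> (a 0 i = k%:R \/ a 0 i = - k%:R -> a != 0)%R.
  move=> ndvd eqa; apply/eqP => a0; move: ndvd; rewrite -Zp_natr_eq0 //.
  by case: eqa; rewrite a0 mxE => /esym/eqP; rewrite ?oppr_eq0 => ->.
have [odd_r|even_r] := boolP (odd r); last first.
  apply: (@zero_sum_magic_even_regular _ _ (const_mx j%:R)%R r) => //.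
    by apply: (nz j 0%R); [rewrite gtnNdvd; lia|left; rewrite mxE].
  apply/rowP => i; rewrite mulmxnE !mxE -mulrnA; apply/eqP.
  by rewrite Zp_natr_eq0 // mulnC.
pose u : 'rV['Z_(2 * j)]_2 := (delta_mx 0 0)%R; pose v : 'rV['Z_(2 * j)]_2 := (delta_mx 0 1)%R.
pose w := (- (v + u *+ (r - 2)))%R.
have n1 : ~~ (2 * j %| 1) by rewrite gtnNdvd; lia.
(* As [j >= 2], the modulus is at least 4, so doubling 1 or -1 never gives 0. *)
have n2 : ~~ (2 * j %| 2) by rewrite gtnNdvd; lia.
(* [r - 2] is odd, while the modulus is even. *)
have nr : ~~ (2 * j %| r - 2).
  apply/negP => /(dvdn_trans (dvdn_mulr j (dvdnn 2))).
  by rewrite dvdn2 oddB // odd_r.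
have [u0 u1 v1] : [/\ u 0 0 = 1, u 0 1 = 0 & v 0 1 = 1]%R by rewrite !mxE.
have w1 : (w 0 1 = - 1)%R by rewrite !(mxE, mulmxnE) !eqxx mul0rn addr0.
apply: (@zero_sum_magic_odd_regular _ _ u v w r) => //.
  by rewrite /w opprD addrA subrr add0r addNr.
have uu : (u + u != 0)%R by apply: (nz 2 0%R) => //; left; rewrite mxE u0 -mulr2n.
have vv : (v + v != 0)%R by apply: (nz 2 1%R) => //; left; rewrite mxE v1 -mulr2n.
have ww : (w + w != 0)%R.
  by apply: (nz 2 1%R) => //; right; rewrite mxE w1 -opprD -mulr2n.
have uv : (u + v != 0)%R by apply: (nz 1 1%R) => //; left; rewrite mxE u1 v1 add0r.
have uw : (u + w != 0)%R by apply: (nz 1 1%R) => //; right; rewrite mxE u1 w1 add0r.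
(* Here oddness of [r] is used: [v + w = - (r - 2) u]. *)
have vw : (v + w != 0)%R.
  apply: (nz (r - 2) 0%R) => //; right.
  by rewrite /w opprD addrA subrr add0r mxE mulmxnE u0.
by move=> a b; rewrite !inE => /or3P[] /eqP -> /or3P[] /eqP -> //; rewrite addrC.
Qed.

Theorem corollary3p2 (j r : nat) (G : multigraph) :
  2 <= j -> 2 <= r -> regular G r ->
  (zeta j G <= ((3 + #|bridges G|)%N%:Z)%:E)%E.
Proof.
move=> j_ge2 r_ge2 regG.
have wit2 : zeta_witness j G 2.
  by apply/andP; split=> //; apply/asboolP; apply: zero_sum_magic_regular_Z2j regG.
(* The witness 2 rules out the infinite value and bounds the minimum. *)
rewrite /zeta; case: pselect => [exc|[]]; last by exists 2.
rewrite lee_fin lez_nat; case: ex_minnP => m _ /(_ 2 wit2) m_le2.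
by apply: leq_trans m_le2 _.
Qed.
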